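(* Let $\mathfrak{g}=\mathfrak{so}_5(\mathbb{C})$ (type $B_2$). Let $\lambda=c_1\varpi_1+c_2\varpi_2$ with $c_1,c_2\in\mathbb{Z}$ and $2\mid c_2$, and let $\mu=n\varpi_1+m\varpi_2$ with $n,m\in\mathbb{N}$ and $2\mid m$. Consider the inequalities $J_1:\ \tfrac{c_2-m}{2}+c_1-n\ge 0$; $J_2:\ c_1+c_2-n-m\ge 0$; $J_3:\ \tfrac{c_2-m}{2}-n-1\ge 0$; $J_4:\ c_1-n-m-1\ge 0$; $J_5:\ -c_1-n-m-3\ge 0$; $J_6:\ \tfrac{-c_2-m}{2}-n-2\ge 0$; $J_7:\ \tfrac{-c_2-m}{2}-c_1-n-3\ge 0$; $J_8:\ -c_1-c_2-n-m-4\ge 0$, and write $\neg J_i$ for the failure of $J_i$. Then $\mathcal{A}(\lambda,\mu)$ equals: $\{1\}$ if $J_1,J_2,\neg J_3,\neg J_4$; $\{s_1\}$ if $J_2,J_3,\neg J_1,\neg J_5$; $\{s_2\}$ if $J_1,J_4,\neg J_2,\neg J_6$; $\{s_2s_1\}$ if $J_3,J_5,\neg J_2,\neg J_7$; $\{s_1s_2\}$ if $J_6,J_4,\neg J_8,\neg J_1$; $\{s_1s_2s_1\}$ if $J_7,J_5,\neg J_8,\neg J_3$; $\{s_2s_1s_2\}$ if $J_6,J_8,\neg J_4,\neg J_7$; $\{(s_2s_1)^2\}$ if $J_7,J_8,\neg J_5,\neg J_6$; $\{1,s_1\}$ if $J_1,J_3,\neg J_4,\neg J_5$; $\{1,s_2\}$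 if $J_2,J_4,\neg J_3,\neg J_6$; $\{s_1,s_2s_1\}$ if $J_2,J_5,\neg J_1,\neg J_7$; $\{s_2,s_1s_2\}$ if $J_1,J_6,\neg J_2,\neg J_8$; $\{s_2s_1,s_1s_2s_1\}$ if $J_3,J_7,\neg J_2,\neg J_8$; $\{s_1s_2,s_2s_1s_2\}$ if $J_4,J_8,\neg J_1,\neg J_7$; $\{s_1s_2s_1,(s_2s_1)^2\}$ if $J_5,J_8,\neg J_6,\neg J_3$; $\{s_2s_1s_2,(s_2s_1)^2\}$ if $J_6,J_7,\neg J_5,\neg J_4$; $\{1,s_1,s_2\}$ if $J_3,J_4,\neg J_5,\neg J_6$; $\{1,s_1,s_2s_1\}$ if $J_1,J_5,\neg J_4,\neg J_7$; $\{1,s_2,s_1s_2\}$ if $J_2,J_6,\neg J_3,\neg J_8$; $\{s_1,s_2s_1,s_1s_2s_1\}$ if $J_7,J_2,\neg J_8,\neg J_1$; $\{s_2,s_1s_2,s_2s_1s_2\}$ if $J_1,J_8,\neg J_2,\neg J_7$; $\{s_2s_1,s_1s_2s_1,(s_2s_1)^2\}$ if $J_3,J_8,\neg J_2,\neg J_6$; $\{s_1s_2,s_2s_1s_2,(s_2s_1)^2\}$ if $J_7,J_4,\neg J_5,\neg J_1$; $\{s_1s_2s_1,s_2s_1s_2,(s_2s_1)^2\}$ if $J_6,J_5,\neg J_4,\neg J_3$; and $\emptyset$ otherwise.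
   Context: $\mathfrak{so}_5(\mathbb{C})$ has simple roots $\alpha_1$ (long), $\alpha_2$ (short), positive roots $\Phi^+=\{\alpha_1,\alpha_2,\alpha_1+\alpha_2,\alpha_1+2\alpha_2\}$, fundamental weights $\varpi_1=\alpha_1+\alpha_2$, $\varpi_2=\tfrac12\alpha_1+\alpha_2$, and $\rho=\varpi_1+\varpi_2=\tfrac32\alpha_1+2\alpha_2$. The Weyl group $W$ (dihedral of order 8) is generated by the simple reflections $s_1,s_2$, acting linearly with $s_i(\alpha_i)=-\alpha_i$, $s_1(\alpha_2)=\alpha_2+\alpha_1$, $s_2(\alpha_1)=\alpha_1+2\alpha_2$, and $s_i(\varpi_j)=\varpi_j-\delta_{ij}\alpha_j$. $\mathbb{N}=\{0,1,2,\dots\}$. Kostant's partition function $\wp(\xi)$ is the number of ways to write $\xi$ as a nonnegative integral linear combination of positive roots. The Weyl alternation set is $\mathcal{A}(\lambda,\mu)=\{\sigma\in W:\ \wp(\sigma(\lambda+\rho)-(\mu+\rho))>0\}$. *)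

(* Defs.v *)
From mathcomp Require Import all_boot all_order all_algebra.
From mathcomp Require Import finmap.
From mathcomp Require Import mathcomp_extra boolp classical_sets cardinality.

Set Implicit Arguments.
Unset Strict Implicit.
Unset Printing Implicit Defensive.

Import Order.TTheory GRing.Theory Num.Theory.
Local Open Scope classical_set_scope.
Local Open Scope ring_scope.

(* The root datum of so_5(C) (type B_2) lives in the rational span of the
   roots; vectors are columns of coordinates in the basis (alpha1, alpha2). *)
Definition alpha1 : 'cV[rat]_2 := delta_mx 0 0.
Definition alpha2 : 'cV[rat]_2 := delta_mx 1 0.

Definition positive_roots : 4.-tuple 'cV[rat]_2 :=
  [tuple alpha1; alpha2; alpha1 + alpha2; alpha1 + 2%:R *: alpha2].

Definition varpi1 : 'cV[rat]_2 := alpha1 + alpha2.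
Definition varpi2 : 'cV[rat]_2 := 2%:R^-1 *: alpha1 + alpha2.
Definition rho : 'cV[rat]_2 := varpi1 + varpi2.

(* The columns are the images of alpha1 and alpha2. Matrices act on columns
   from the left, so that s1 * s2 is "first s2, then s1". *)
Definition s1 : 'M[rat]_2 := row_mx (- alpha1) (alpha2 + alpha1).
Definition s2 : 'M[rat]_2 := row_mx (alpha1 + 2%:R *: alpha2) (- alpha2).

Definition weyl_group : set 'M[rat]_2 :=
  smallest [set G | [/\ G 1, forall x y, G x -> G y -> G (x * y)
                      & forall x, G x -> G x^-1]]
           [set s1; s2].

Definition kostant_ways (xi : 'cV[rat]_2) : set {ffun 'I_4 -> nat} :=
  [set k | xi = \sum_i tnth positive_roots i *+ k i].

(* fset_set is the empty finite set on infinite sets; kostant_ways xi is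
   always finite, see finite_kostant_ways below. *)
Definition kostant_partition (xi : 'cV[rat]_2) : nat :=
  #|` fset_set (kostant_ways xi)|%fset.

Definition weyl_alternation_set (lambda mu : 'cV[rat]_2) : set 'M[rat]_2 :=
  [set sigma | weyl_group sigma /\
     (0 < kostant_partition (sigma *m (lambda + rho) - (mu + rho)))%N].

Lemma cV2P (u v : 'cV[rat]_2) : u 0 0 = v 0 0 -> u 1 0 = v 1 0 -> u = v.
Proof.
move=> uv0 uv1; apply/matrixP => i j; rewrite ord1.
by case: i => -[|[|//]] lt_i; [move: uv0|move: uv1];
   congr (u _ _ = v _ _); apply: val_inj.
Qed.

Lemma s1E (v : 'cV[rat]_2) : (s1 *m v) 0 0 = v 1 0 - v 0 0 /\ (s1 *m v) 1 0 = v 1 0.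
Proof.
have -> : v = v 0 0 *: alpha1 + v 1 0 *: alpha2.
  by apply: cV2P; rewrite !mxE /= ?mulr1 ?mulr0 ?addr0 ?add0r.
rewrite !mxE !big_ord_recl !big_ord0 !mxE.
split; do 2![case: splitP => ?; rewrite ?ord1 //= => _];
  by rewrite !mxE /= !(mulr0, mulr1, addr0, add0r, mul0r, mul1r, mulN1r, oppr0) // addrC.
Qed.

Lemma s2E (v : 'cV[rat]_2) : (s2 *m v) 0 0 = v 0 0 /\ (s2 *m v) 1 0 = 2%:R * v 0 0 - v 1 0.
Proof.
have -> : v = v 0 0 *: alpha1 + v 1 0 *: alpha2.
  by apply: cV2P; rewrite !mxE /= ?mulr1 ?mulr0 ?addr0 ?add0r.
rewrite !mxE !big_ord_recl !big_ord0 !mxE.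
split; do 2![case: splitP => ?; rewrite ?ord1 //= => _];
  by rewrite !mxE /= !(mulr0, mulr1, addr0, add0r, mul0r, mul1r, mulN1r, oppr0).
Qed.

Lemma s1_simple_roots : s1 *m alpha1 = - alpha1 /\ s1 *m alpha2 = alpha2 + alpha1.
Proof. by split; apply: cV2P; rewrite ?(proj1 (s1E _)) ?(proj2 (s1E _)) !mxE. Qed.

Lemma s2_simple_roots :
  s2 *m alpha1 = alpha1 + 2%:R *: alpha2 /\ s2 *m alpha2 = - alpha2.
Proof. by split; apply: cV2P; rewrite ?(proj1 (s2E _)) ?(proj2 (s2E _)) !mxE. Qed.

Lemma s1_varpi : s1 *m varpi1 = varpi1 - alpha1 /\ s1 *m varpi2 = varpi2.
Proof. by split; apply: cV2P; rewrite ?(proj1 (s1E _)) ?(proj2 (s1E _)) !mxE. Qed.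

Lemma s2_varpi : s2 *m varpi1 = varpi1 /\ s2 *m varpi2 = varpi2 - alpha2.
Proof. by split; apply: cV2P; rewrite ?(proj1 (s2E _)) ?(proj2 (s2E _)) !mxE. Qed.

Lemma rhoE : rho = (3%:R / 2%:R) *: alpha1 + 2%:R *: alpha2.
Proof. by apply: cV2P; rewrite !mxE. Qed.

Lemma finite_kostant_ways xi : finite_set (kostant_ways xi).
Proof.
pose N := Num.truncn (xi 0 0 + xi 1 0).
pose f (h : {ffun 'I_4 -> 'I_N.+1}) := [ffun i => val (h i)].
apply: (@sub_finite_set _ _ (f @` setT)); last exact/finite_image/finite_finset.
move=> k /= xiE; exists [ffun i => inord (k i)] => //.
apply/ffunP => i; rewrite !ffunE /= inordK // ltnS /N.
have sum_xi : xi 0 0 + xi 1 0 = \sum_i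
    (tnth positive_roots i 0 0 + tnth positive_roots i 1 0) *+ k i.
  by rewrite xiE !summxE -big_split; apply: eq_bigr => j _;
     rewrite mulrnDl !mulmxnE.
have root_ge1 j :
    1 <= tnth positive_roots j 0 0 + tnth positive_roots j 1 0.
  by case: j => -[|[|[|[|//]]]] ?; rewrite (tnth_nth 0) /= !mxE.
have ki_le : (k i)%:R <= xi 0 0 + xi 1 0.
  rewrite sum_xi (bigD1 i) //= -[leLHS]addr0 lerD ?ler_wMn2r ?sumr_ge0 // => j _.
  exact/mulrn_wge0/(le_trans ler01)/root_ge1.
by rewrite truncn_ge_nat // (le_trans _ ki_le).
Qed.

(* Main.v *)
(* A vector has positive partition function exactly when its two coordinates in
   the basis (alpha1, alpha2) are natural numbers. The parity assumptions make
   all the coordinates of sigma (lambda + rho) - (mu + rho) integers, and for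
   each of the eight sigma they are two of the left-hand sides of J1, ..., J8.
   So every sigma contributes to the alternation set iff a fixed pair of the J_i
   holds, and what remains is to see which sign patterns of the J_i are
   compatible with n, m >= 0. *)
Require Import Defs.
From mathcomp Require Import all_boot all_order all_algebra.
From mathcomp Require Import finmap ring lra.
From mathcomp Require Import mathcomp_extra boolp classical_sets cardinality.

Import Order.TTheory GRing.Theory Num.Theory.
Local Open Scope classical_set_scope.
Local Open Scope ring_scope.

(** The alternation set is first obtained as a sublist of the Weyl group; this and [set_seq3] bring
    it to the explicit form of the theorem. *)
Lemma set_seq2 (T : eqType) (x y : T) : [set` [:: x; y]] = [set x; y].
Proof.
apply/seteqP; split=> z /=; rewrite !inE.
  by case/orP=> /eqP; [left|right].
by case=> ->; rewrite eqxx ?orbT.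
Qed.

Lemma set_seq3 (T : eqType) (x y z : T) : [set` [:: x; y; z]] = [set x; y; z].
Proof.
apply/seteqP; split=> t /=; rewrite !inE.
  by case/or3P=> /eqP; [left; left|left; right|right].
by case=> [[]|] ->; rewrite eqxx ?orbT.
Qed.

(** Stated for the whole column, [s1E] becomes a rewrite rule that also unfolds words in the
    reflections. *)
Lemma s1_col (v : 'cV[rat]_2) : s1 *m v = \col_i [:: v 1 0 - v 0 0; v 1 0]`_i.
Proof. by have [h0 h1] := s1E v; apply: cV2P; rewrite [RHS]mxE. Qed.

Lemma s2_col (v : 'cV[rat]_2) :
  s2 *m v = \col_i [:: v 0 0; 2%:R * v 0 0 - v 1 0]`_i.
Proof. by have [h0 h1] := s2E v; apply: cV2P; rewrite [RHS]mxE. Qed.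

Lemma eq_mulmx_cV (A B : 'M[rat]_2) :
  (forall v : 'cV[rat]_2, A *m v = B *m v) -> A = B.
Proof.
move=> AB; apply/matrixP => i j.
have /matrixP/(_ i 0) := AB (delta_mx j 0).
by rewrite -!colE !mxE.
Qed.

Lemma s1_invol : s1 * s1 = 1.
Proof.
apply: eq_mulmx_cV => v; rewrite -mulmxE -mulmxA mul1mx !s1_col.
by apply: cV2P; rewrite !mxE /=; ring.
Qed.

Lemma s2_invol : s2 * s2 = 1.
Proof.
apply: eq_mulmx_cV => v; rewrite -mulmxE -mulmxA mul1mx !s2_col.
by apply: cV2P; rewrite !mxE /=; ring.
Qed.

Lemma s1_s2_braid : s1 * (s2 * (s1 * s2)) = s2 * (s1 * (s2 * s1)).
Proof.
apply: eq_mulmx_cV => v; rewrite -!mulmxE -!mulmxA !(s1_col, s2_col).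
by apply: cV2P; rewrite !mxE /=; ring.
Qed.

(** The order matters: the lists of conditions below follow it entry by entry. The last entry is the
    longest element, which acts as -1. *)
Definition weyl_elements : seq 'M[rat]_2 :=
  [:: 1; s1; s2; s2 * s1; s1 * s2; s1 * s2 * s1; s2 * s1 * s2; (s2 * s1) ^+ 2].

Lemma s1_weyl_elements x : x \in weyl_elements -> s1 * x \in weyl_elements.
Proof.
have K y : s1 * (s1 * y) = y by rewrite mulrA s1_invol mul1r.
rewrite !inE expr2 -!mulrA; do 7?case/orP; move/eqP->;
  (* The reversed braid relation spells the longest element with a leading [s1], which cancels
     against a further [s1]. *)
  by rewrite ?(mulr1, s1_invol, K, s1_s2_braid) -?s1_s2_braid ?K ?eqxx ?orbT.
Qed.

Lemma s2_weyl_elements x : x \in weyl_elements -> s2 * x \in weyl_elements.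
Proof.
have K y : s2 * (s2 * y) = y by rewrite mulrA s2_invol mul1r.
rewrite !inE expr2 -!mulrA; do 7?case/orP; move/eqP->;
  by rewrite ?(mulr1, s2_invol, K) ?eqxx ?orbT.
Qed.

(* A finite set stable under left multiplication by the two involutions s1, s2
   contains the whole group as soon as it contains 1. *)
Lemma weyl_groupE x : weyl_group x <-> x \in weyl_elements.
Proof.
have unit_invol (s : 'M[rat]_2) : s * s = 1 -> s \is a GRing.unit /\ s^-1 = s.
  move=> ss; have us : s \is a GRing.unit by apply/unitrP; exists s.
  by split=> //; apply: (mulrI us); rewrite divrr.
split=> [wx|].
(* Asking for stability under both [y] and its inverse makes [G] closed under inversion by
   construction. *)
- pose G := [set y : 'M[rat]_2 | [/\ y \is a GRing.unit,
    forall z, z \in weyl_elements -> y * z \in weyl_elements &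
    forall z, z \in weyl_elements -> y^-1 * z \in weyl_elements]].
  have [] : G x.
    apply: wx; split=> [|_ [] ->].
    + split=> [|y z [uy y1 y2] [uz z1 z2]|y [uy y1 y2]].
      * by split=> [|z|z]; rewrite ?unitr1 ?invr1 ?mul1r.
      * split=> [|t wt|t wt]; first by rewrite unitrMl.
          by rewrite -mulrA; apply/y1/z1.
        by rewrite invrM // -mulrA; apply/z2/y2.
      * by split; rewrite ?unitrV ?invrK.
    + have [u1 v1] := unit_invol _ s1_invol.
      by split; rewrite ?v1 //; exact: s1_weyl_elements.
    + have [u2 v2] := unit_invol _ s2_invol.
      by split; rewrite ?v2 //; exact: s2_weyl_elements.
  by move=> _ /(_ 1) + _; rewrite mulr1; apply; rewrite inE eqxx.
- move=> wx G [[G1 GM _] Gs].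
  have Gs1 : G s1 by apply: Gs; left.
  have Gs2 : G s2 by apply: Gs; right.
  by move: wx; rewrite !inE expr2; do 7?case/orP; move/eqP->; do ?apply: (GM).
Qed.

(* alpha1 and alpha2 are themselves positive roots, so they alone realise every
   vector with natural coordinates. *)
Lemma kostant_partition_gt0 (xi : 'cV[rat]_2) :
  (0 < kostant_partition xi)%N =
  (xi 0 0 \is a Num.nat) && (xi 1 0 \is a Num.nat).
Proof.
rewrite cardfs_gt0; apply/fset0Pn/andP => [[k]|[]].
  rewrite in_fset_set ?inE /=; last exact: finite_kostant_ways.
  move=> ->; rewrite !summxE; split; apply: rpred_sum => -[[|[|[|[|//]]]] ?] _;
    by rewrite (tnth_nth 0) /= mulmxnE rpredMn // !mxE.
move=> /natrP[a xa] /natrP[b xb].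
(* The default 0 of [nth] is the multiplicity of the two non-simple roots. *)
exists [ffun i : 'I_4 => nth 0%N [:: a; b] i].
rewrite in_fset_set ?inE /kostant_ways /=; last exact: finite_kostant_ways.
rewrite !big_ord_recl big_ord0 !ffunE !(tnth_nth 0) /= !mulr0n !addr0.
by apply: cV2P; rewrite [RHS]mxE !mulmxnE ?xa ?xb !mxE /= ?mul0rn ?addr0 ?add0r.
Qed.

(** In coordinates [s1] is (x, y) -> (y - x, y) and [s2] is (x, y) -> (x, 2x - y); composing these
    along each word gives the eight pairs, shifted by [v]. *)
Lemma kostant_partition_weyl_elements (u v : 'cV[rat]_2) :
  let x := u 0 0 in let y := u 1 0 in let k := v 0 0 in let l := v 1 0 in
  [seq (0 < kostant_partition (s *m u - v))%N | s <- weyl_elements] =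
  [seq (p.1 \is a Num.nat) && (p.2 \is a Num.nat) | p <-
    [:: (x - k, y - l); (y - x - k, y - l); (x - k, 2%:R * x - y - l);
        (y - x - k, y - 2%:R * x - l); (x - y - k, 2%:R * x - y - l);
        (- x - k, y - 2%:R * x - l); (x - y - k, - y - l); (- x - k, - y - l)]].
Proof.
have gt0E (w : 'cV[rat]_2) (a b : rat) : w 0 0 = a -> w 1 0 = b ->
    (0 < kostant_partition (w - v))%N =
    (a - v 0 0 \is a Num.nat) && (b - v 1 0 \is a Num.nat).
  by move=> <- <-; rewrite kostant_partition_gt0 !mxE.
move=> x y k l; rewrite /= expr2 -!mulmxE -!mulmxA mul1mx !(s1_col, s2_col).
by congr [:: _; _; _; _; _; _; _; _]; apply: gt0E; rewrite /x /y;
  do ?rewrite !mxE /=; ring.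
Qed.


Theorem theorem3p2 (c1 c2 : int) (n m : nat)
    (hc2 : (2 %| c2)%Z) (hm : (2 %| m)%N) :
  let lambda : 'cV[rat]_2 := c1%:~R *: varpi1 + c2%:~R *: varpi2 in
  let mu : 'cV[rat]_2 := n%:R *: varpi1 + m%:R *: varpi2 in
  let A := weyl_alternation_set lambda mu in
  let C1 : rat := c1%:~R in
  let C2 : rat := c2%:~R in
  let N : rat := n%:R in
  let M : rat := m%:R in
  let J1 : bool := (C2 - M) / 2%:R + C1 - N >= 0 in
  let J2 : bool := C1 + C2 - N - M >= 0 in
  let J3 : bool := (C2 - M) / 2%:R - N - 1 >= 0 in
  let J4 : bool := C1 - N - M - 1 >= 0 in
  let J5 : bool := - C1 - N - M - 3%:R >= 0 in
  let J6 : bool := (- C2 - M) / 2%:R - N - 2%:R >= 0 in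
  let J7 : bool := (- C2 - M) / 2%:R - C1 - N - 3%:R >= 0 in
  let J8 : bool := - C1 - C2 - N - M - 4%:R >= 0 in
  ([&& J1, J2, ~~ J3 & ~~ J4] ->
     A = [set 1]) /\
  ([&& J2, J3, ~~ J1 & ~~ J5] ->
     A = [set s1]) /\
  ([&& J1, J4, ~~ J2 & ~~ J6] ->
     A = [set s2]) /\
  ([&& J3, J5, ~~ J2 & ~~ J7] ->
     A = [set s2 * s1]) /\
  ([&& J6, J4, ~~ J8 & ~~ J1] ->
     A = [set s1 * s2]) /\
  ([&& J7, J5, ~~ J8 & ~~ J3] ->
     A = [set s1 * s2 * s1]) /\
  ([&& J6, J8, ~~ J4 & ~~ J7] ->
     A = [set s2 * s1 * s2]) /\
  ([&& J7, J8, ~~ J5 & ~~ J6] ->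
     A = [set (s2 * s1) ^+ 2]) /\
  ([&& J1, J3, ~~ J4 & ~~ J5] ->
     A = [set 1; s1]) /\
  ([&& J2, J4, ~~ J3 & ~~ J6] ->
     A = [set 1; s2]) /\
  ([&& J2, J5, ~~ J1 & ~~ J7] ->
     A = [set s1; s2 * s1]) /\
  ([&& J1, J6, ~~ J2 & ~~ J8] ->
     A = [set s2; s1 * s2]) /\
  ([&& J3, J7, ~~ J2 & ~~ J8] ->
     A = [set s2 * s1; s1 * s2 * s1]) /\
  ([&& J4, J8, ~~ J1 & ~~ J7] ->
     A = [set s1 * s2; s2 * s1 * s2]) /\
  ([&& J5, J8, ~~ J6 & ~~ J3] ->
     A = [set s1 * s2 * s1; (s2 * s1) ^+ 2]) /\
  ([&& J6, J7, ~~ J5 & ~~ J4] ->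
     A = [set s2 * s1 * s2; (s2 * s1) ^+ 2]) /\
  ([&& J3, J4, ~~ J5 & ~~ J6] ->
     A = [set 1; s1; s2]) /\
  ([&& J1, J5, ~~ J4 & ~~ J7] ->
     A = [set 1; s1; s2 * s1]) /\
  ([&& J2, J6, ~~ J3 & ~~ J8] ->
     A = [set 1; s2; s1 * s2]) /\
  ([&& J7, J2, ~~ J8 & ~~ J1] ->
     A = [set s1; s2 * s1; s1 * s2 * s1]) /\
  ([&& J1, J8, ~~ J2 & ~~ J7] ->
     A = [set s2; s1 * s2; s2 * s1 * s2]) /\
  ([&& J3, J8, ~~ J2 & ~~ J6] ->
     A = [set s2 * s1; s1 * s2 * s1; (s2 * s1) ^+ 2]) /\
  ([&& J7, J4, ~~ J5 & ~~ J1] ->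
     A = [set s1 * s2; s2 * s1 * s2; (s2 * s1) ^+ 2]) /\
  ([&& J6, J5, ~~ J4 & ~~ J3] ->
     A = [set s1 * s2 * s1; s2 * s1 * s2; (s2 * s1) ^+ 2]) /\
  (~~ [|| [&& J1, J2, ~~ J3 & ~~ J4],
          [&& J2, J3, ~~ J1 & ~~ J5],
          [&& J1, J4, ~~ J2 & ~~ J6],
          [&& J3, J5, ~~ J2 & ~~ J7],
          [&& J6, J4, ~~ J8 & ~~ J1],
          [&& J7, J5, ~~ J8 & ~~ J3],
          [&& J6, J8, ~~ J4 & ~~ J7],
          [&& J7, J8, ~~ J5 & ~~ J6],
          [&& J1, J3, ~~ J4 & ~~ J5],
          [&& J2, J4, ~~ J3 & ~~ J6],
          [&& J2, J5, ~~ J1 & ~~ J7],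
          [&& J1, J6, ~~ J2 & ~~ J8],
          [&& J3, J7, ~~ J2 & ~~ J8],
          [&& J4, J8, ~~ J1 & ~~ J7],
          [&& J5, J8, ~~ J6 & ~~ J3],
          [&& J6, J7, ~~ J5 & ~~ J4],
          [&& J3, J4, ~~ J5 & ~~ J6],
          [&& J1, J5, ~~ J4 & ~~ J7],
          [&& J2, J6, ~~ J3 & ~~ J8],
          [&& J7, J2, ~~ J8 & ~~ J1],
          [&& J1, J8, ~~ J2 & ~~ J7],
          [&& J3, J8, ~~ J2 & ~~ J6],
          [&& J7, J4, ~~ J5 & ~~ J1]
        | [&& J6, J5, ~~ J4 & ~~ J3]] ->
     A = set0).
Proof.
move=> lambda mu A C1 C2 N M J1 J2 J3 J4 J5 J6 J7 J8.
pose P s := (0 < kostant_partition (s *m (lambda + rho) - (mu + rho)))%N.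
(* As a mask, [A] computes as soon as the eight Booleans are known. *)
have AE : A = [set` mask (map P weyl_elements) weyl_elements].
  rewrite -filter_mask; apply/seteqP; split=> s; rewrite /mkset mem_filter.
    by case=> /weyl_groupE ws Ps; rewrite ws andbT.
  by case/andP=> Ps ws; split=> //; apply/weyl_groupE.
have PE : map P weyl_elements = [:: J1 && J2; J3 && J2; J1 && J4; J3 && J5;
                                    J6 && J4; J7 && J5; J6 && J8; J7 && J8].
  rewrite /P kostant_partition_weyl_elements.
  have [-> ->] : (lambda + rho) 0 0 = C1 + 1 + (C2 + 1) / 2%:R /\
                 (lambda + rho) 1 0 = C1 + C2 + 2%:R.
    by rewrite !mxE /=; split; field.
  have [-> ->] : (mu + rho) 0 0 = N + 1 + (M + 1) / 2%:R /\
                 (mu + rho) 1 0 = N + M + 2%:R.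
    by rewrite !mxE /=; split; field.
  (* For an integer, being natural is a matter of sign; [q] is the left-hand side of the matching
     inequality. *)
  have natE (q r : rat) :
      r = q -> q \is a Num.int -> (r \is a Num.nat) = (0 <= q).
    by move=> -> qint; rewrite natrEint qint.
  have intC1 : C1 \is a Num.int by exact: intr_int.
  have intC2 : C2 \is a Num.int by exact: intr_int.
  have intN : N \is a Num.int by exact: natr_int.
  have intM : M \is a Num.int by exact: natr_int.
  (* Parity enters only here and for [M]; the halves coming from [rho] cancel. *)
  have intC2' : C2 / 2%:R \is a Num.int.
    rewrite /C2; have /dvdzP[b ->] := hc2.
    by rewrite intrM mulfK // intr_int.
  have intM' : M / 2%:R \is a Num.int.
    rewrite /M; have /dvdnP[p ->] := hm.
    by rewrite natrM mulfK // natr_int.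
  rewrite {AE A P hc2 hm lambda mu}/= /J1 /J2 /J3 /J4 /J5 /J6 /J7 /J8.
  clear J1 J2 J3 J4 J5 J6 J7 J8.
  move: C1 C2 N M intC1 intC2 intN intM intC2' intM'.
  move=> {c1 c2 n m} C1 C2 N M intC1 intC2 intN intM intC2' intM'.
  congr [:: _ && _; _ && _; _ && _; _ && _; _ && _; _ && _; _ && _; _ && _];
    (apply: natE; first by field);
    by rewrite ?mulrBl ?mulNr ?(rpredB, rpredD, rpredN) ?natr_int ?rpred1.
have N_ge0 : 0 <= N by exact: ler0n.
have M_ge0 : 0 <= M by exact: ler0n.
rewrite {}AE {}PE {A P lambda mu hc2 hm}.
move: @J1 @J2 @J3 @J4 @J5 @J6 @J7 @J8.
(* Integrality can now be forgotten: the impossible sign patterns are already contradictory over the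
   rationals. *)
move: C1 C2 N M N_ge0 M_ge0 => {c1 c2 n m} C1 C2 N M N_ge0 M_ge0.
(* Only 33 of the 256 sign patterns are feasible. *)
case: leP => h1; case: leP => h2; case: leP => h3; try (exfalso; lra);
  case: leP => h4; try (exfalso; lra); case: leP => h5; try (exfalso; lra);
  case: leP => h6; try (exfalso; lra); case: leP => h7; try (exfalso; lra);
  case: leP => h8; try (exfalso; lra);
  move=> J1 J2 J3 J4 J5 J6 J7 J8;
  clear h1 h2 h3 h4 h5 h6 h7 h8 N_ge0 M_ge0;
  (* With all signs fixed, each of the 25 clauses either has a false premise or equates the computed
     mask with an explicit set. *)
  do 24?split=> /=; rewrite /weyl_elements /=; try by [];
  by rewrite ?set_nil ?set_cons1 ?set_seq2 ?set_seq3.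
Qed.
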